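(* Let $G$ be a finite simple connected graph. Then $\chi_g(G)=3$ if and only if $G\cong P_n$ for some $n\in\{3,4\}$, where $\chi_g(G)$ is the graceful chromatic number of $G$ and $P_n$ is the path on $n$ vertices.
   Context: For a positive integer $l$, write $[1,l]=\{1,2,\dots,l\}$. A graceful coloring of a simple graph $G$ with $l$ colors, where $l\ge 2$ is an integer, is a proper vertex coloring $g:V(G)\to[1,l]$ (adjacent vertices receive distinct values) such that the induced edge coloring $g^*:E(G)\to[1,l-1]$, $g^*(ab)=|g(a)-g(b)|$ for each edge $ab$, is a proper edge coloring (any two distinct edges sharing an endpoint receive distinct values). The graceful chromatic number $\chi_g(G)$ is the smallest integer $l\ge 2$ for which $G$ has a graceful coloring $g:V(G)\to[1,l]$. *)

(* Defs.v *)
From mathcomp Require Import all_boot ssralg ssrint zify.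

Set Implicit Arguments.
Unset Strict Implicit.
Unset Printing Implicit Defensive.

Record sgraph := SGraph {
  vertex :> finType;
  adj : rel vertex;
  adj_sym : symmetric adj;
  adj_irrefl : irreflexive adj
}.

(* The graph without vertices is not connected. *)
Definition connected_graph (G : sgraph) : Prop :=
  0 < #|G| /\ forall x y : G, connect (@adj G) x y.

Definition graph_iso (G H : sgraph) : Prop :=
  exists f : G -> H, bijective f /\ forall x y : G, adj (f x) (f y) = adj x y.

Definition path_adj (n : nat) : rel 'I_n :=
  fun i j => (i.+1 == j :> nat) || (j.+1 == i :> nat).

Lemma path_adj_sym n : symmetric (@path_adj n).
Proof. by move=> i j; rewrite /path_adj orbC. Qed.

Lemma path_adj_irrefl n : irreflexive (@path_adj n).
Proof. by move=> i; rewrite /path_adj orbb; apply/eqP; lia. Qed.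

Definition path_graph (n : nat) : sgraph :=
  SGraph (@path_adj_sym n) (@path_adj_irrefl n).

Section Coloring.

Variable G : sgraph.

(* Edge colorings are functions of the two endpoints of an edge. *)
Definition induced_edge_coloring (g : G -> nat) (x y : G) : nat :=
  `|g x - g y|%N.

Lemma induced_edge_coloringC g x y :
  induced_edge_coloring g x y = induced_edge_coloring g y x.
Proof. by rewrite /induced_edge_coloring distnC. Qed.

Definition proper_vertex_coloring (g : G -> nat) : bool :=
  [forall x : G, forall y : G, adj x y ==> (g x != g y)].

(* In a simple graph, two distinct edges that share an endpoint are xy and xz
   with y <> z. *)
Definition proper_edge_coloring (c : G -> G -> nat) : bool :=
  [forall x : G, forall y : G, forall z : G,
    [&& adj x y, adj x z & y != z] ==> (c x y != c x z)].

Definition graceful_coloring (l : nat) (g : G -> nat) : bool :=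
  [&& [forall x : G, 1 <= g x <= l],
      proper_vertex_coloring g
    & proper_edge_coloring (induced_edge_coloring g)].

(* The requirement that the induced edge colors lie in [1, l - 1] is
   automatic. *)
Lemma induced_edge_coloring_range l g x y :
  graceful_coloring l g -> adj x y ->
  1 <= induced_edge_coloring g x y <= l.-1.
Proof.
move=> /and3P[/forallP gl /forallP gP _] xy.
move: (gl x) (gl y) (gP x) => glx gly /forallP/(_ y)/implyP/(_ xy)/eqP gxy.
by rewrite /induced_edge_coloring; lia.
Qed.

(* Values in 'I_l.+1 keep the search space finite; graceful_coloring excludes
   the value 0. *)
Definition gracefully_colorable (l : nat) : bool :=
  [exists g : {ffun G -> 'I_l.+1}, graceful_coloring l (fun x => g x)].

Lemma gracefully_colorableP (l : nat) :
  reflect (exists g : G -> nat, graceful_coloring l g)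
          (gracefully_colorable l).
Proof.
apply: (iffP existsP) => [[g gP]|[g gP]]; first by exists (fun x => nat_of_ord (g x)).
have gl x : g x < l.+1.
  by case/and3P: gP => /forallP/(_ x)/andP[_ ?].
exists [ffun x => Ordinal (gl x)].
case/and3P: gP => /forallP g1 /forallP g2 /forallP g3.
apply/and3P; split; apply/forallP => x.
- by rewrite ffunE /= g1.
- apply/forallP => y; rewrite !ffunE /=; exact: (forallP (g2 x)).
- apply/forallP => y; apply/forallP => z.
  rewrite /induced_edge_coloring !ffunE /=.
  exact: (forallP (forallP (g3 x) y)).
Qed.

(* Distinct powers of 2 color every graph: 2 ^ a + 2 ^ b = 2 ^ (c + 1) forces
   a = b. *)
Lemma gracefully_colorable_exists :
  exists l, (2 <= l) && gracefully_colorable l.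
Proof.
pose r (x : G) : nat := enum_rank x.
have rI x y : r x = r y -> x = y by move/val_inj/enum_rank_inj.
have P a b : a < b -> 2 * 2 ^ a <= 2 ^ b.
  by move=> ab; rewrite -expnS leq_exp2l.
have P0 a : 0 < 2 ^ a by rewrite expn_gt0.
exists (2 ^ #|G|.+1); rewrite expnS leq_pmulr //=.
apply/gracefully_colorableP; exists (fun x => 2 ^ r x).
apply/and3P; split; apply/forallP => x.
- rewrite P0 /= -expnS leq_exp2l //.
  by apply: ltnW; apply: leq_trans (ltn_ord (enum_rank x)) _.
- apply/forallP => y; apply/implyP => xy; rewrite eqn_exp2l //.
  apply/eqP => /rI xE; by rewrite xE adj_irrefl in xy.
- apply/forallP => y; apply/forallP => z; apply/implyP => /and3P[xy xz yz].
  have nxy : r x <> r y by move/rI => xE; rewrite xE adj_irrefl in xy.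
  have nxz : r x <> r z by move/rI => xE; rewrite xE adj_irrefl in xz.
  have nyz : r y <> r z by move/rI => yE; rewrite yE eqxx in yz.
  rewrite /induced_edge_coloring; apply/eqP.
  move: (r x) (r y) (r z) nxy nxz nyz => a b c nab nac nbc.
  move: (P a b) (P b a) (P a c) (P c a) (P b c) (P c b) (P0 a) (P0 b) (P0 c).
  by move: (2 ^ a) (2 ^ b) (2 ^ c) => A B C; lia.
Qed.

Definition graceful_chromatic_number : nat :=
  ex_minn gracefully_colorable_exists.

End Coloring.

(* Main.v *)
(** In a graceful 3-coloring every edge at a vertex of color 2 is colored 1, so
    such a vertex has degree at most 1, while a vertex of color 1 or 3 has at
    most one neighbor of each other color. If no edge joins the colors 1 and 3,
    merging these two colors gives a graceful 2-coloring. Otherwise the connected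
    graph is a subpath, containing such an edge, of a path colored 2, 1, 3, 2. *)
Require Import Defs.
From mathcomp Require Import all_boot ssralg ssrint zify.

Set Implicit Arguments.
Unset Strict Implicit.
Unset Printing Implicit Defensive.

Lemma graceful_coloringP (G : sgraph) (l : nat) (g : G -> nat) :
  reflect [/\ forall x, 1 <= g x <= l,
              forall x y, adj x y -> g x <> g y
            & forall x y z, adj x y -> adj x z ->
                `|g x - g y|%N = `|g x - g z|%N -> y = z]
          (graceful_coloring l g).
Proof.
apply: (iffP and3P) => [[/forallP g1 /forallP g2 /forallP g3]|[g1 g2 g3]].
  split=> // [x y xy|x y z xy xz gyz]; apply/eqP.
    by move/forallP/(_ y)/implyP: (g2 x); apply.
  apply/negPn/negP => yz.
  move/forallP/(_ y)/forallP/(_ z)/implyP: (g3 x).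
  by rewrite xy xz yz /induced_edge_coloring gyz eqxx => /(_ isT).
split; apply/forallP => x; first exact: g1.
  by apply/forallP => y; apply/implyP => /g2/eqP.
apply/forallP => y; apply/forallP => z; apply/implyP => /and3P[xy xz yz].
by apply: contra yz => /eqP/g3 ->.
Qed.

(** The minimum ranges over [l >= 2], so 2 is the only smaller value to exclude. *)
Lemma graceful_chromatic_number3E (G : sgraph) :
  graceful_chromatic_number G = 3 <->
  gracefully_colorable G 3 /\ ~~ gracefully_colorable G 2.
Proof.
rewrite /graceful_chromatic_number; case: ex_minnP => m /andP[m2 cm] min.
split=> [m3|[c3 c2]].
  rewrite m3 in cm min; split=> //; apply/negP => c2.
  by have := min 2; rewrite c2 => /(_ isT).
have := min 3 c3; case: m m2 cm min => [|[|[|[|]]]] //= _ cm.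
by rewrite cm in c2.
Qed.

(** With colors 1 and 2 only, every edge is colored 1, so two edges at [x] clash. *)
Lemma not_gracefully_colorable2 (G : sgraph) (x y z : G) :
  adj x y -> adj x z -> y != z -> ~~ gracefully_colorable G 2.
Proof.
move=> xy xz yz; apply/negP => /gracefully_colorableP[g].
move=> /graceful_coloringP[g1 g2 g3]; move/eqP: yz; apply.
apply: (g3 _ _ _ xy xz); move: (g1 x) (g1 y) (g1 z) (g2 x y xy) (g2 x z xz); lia.
Qed.

Lemma graceful_coloring_merge13 (G : sgraph) (g : G -> nat) :
  graceful_coloring 3 g ->
  (forall x y, adj x y -> g x = 1 -> g y <> 3) ->
  graceful_coloring 2 (fun x => if g x == 2 then 2 else 1).
Proof.
move=> /graceful_coloringP[g1 g2 g3] n13.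
have e1 x y : adj x y -> `|g x - g y|%N = 1.
  move=> xy; have yx : adj y x by rewrite adj_sym.
  by move: (g1 x) (g1 y) (g2 x y xy) (n13 x y xy) (n13 y x yx); lia.
apply/graceful_coloringP; split=> [x|x y xy|x y z xy xz _].
- by case: ifP.
- by move: (g1 x) (g1 y) (e1 x y xy); do 2!case: eqP; lia.
(* By [e1] all edges already have color 1 under [g], so [x] has at most one neighbor. *)
- by apply: (g3 x) => //; rewrite !e1.
Qed.

(** An embedding of [G] as an induced subgraph of the infinite path on [nat]; which positions are
    occupied is left open. *)
Definition path_placement (G : sgraph) (f : G -> nat) : Prop :=
  injective f /\
  forall x y : G, adj x y = ((f x).+1 == f y) || ((f y).+1 == f x).

Lemma path_placement_iso (G : sgraph) (f : G -> nat) (k n : nat) :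
  path_placement f -> (forall x, k <= f x < k + n) ->
  (forall i, i < n -> exists x, f x = k + i) -> graph_iso G (path_graph n).
Proof.
move=> [f_inj f_adj] f_range f_onto.
have f_lt x : f x - k < n by have := f_range x; lia.
have /fin_all_exists[h hP] (i : 'I_n) : exists x, f x = k + i by apply: f_onto.
exists (fun x => Ordinal (f_lt x) : path_graph n); split.
  exists h => [x|i]; last by apply: val_inj; rewrite /= hP; lia.
  by apply: f_inj; rewrite hP /=; have := f_range x; lia.
move=> x y; rewrite f_adj /= /path_adj /=.
by have := f_range x; have := f_range y; lia.
Qed.

(** The positions themselves serve as colors. *)
Lemma path_placement_colorable2 (G : sgraph) (f : G -> nat) :
  path_placement f -> (forall x, 1 <= f x <= 2) -> gracefully_colorable G 2.
Proof.
move=> [f_inj f_adj] f_range; apply/gracefully_colorableP; exists f.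
apply/graceful_coloringP; split=> // [x y|x y z]; rewrite !f_adj; first lia.
by move=> *; apply: f_inj; have := f_range y; have := f_range z; lia.
Qed.

Section PathPlacement.

Variables (G : sgraph) (g : G -> nat) (a b : G).
Hypotheses (hG : connected_graph G) (hg : graceful_coloring 3 g).
Hypotheses (ab : adj a b) (ga : g a = 1) (gb : g b = 3).

Let g1 : forall x, 1 <= g x <= 3.
Proof. by case/graceful_coloringP: hg. Qed.

Let g2 : forall x y, adj x y -> g x <> g y.
Proof. by case/graceful_coloringP: hg. Qed.

Let g3 : forall x y z, adj x y -> adj x z ->
  `|g x - g y|%N = `|g x - g z|%N -> y = z.
Proof. by case/graceful_coloringP: hg. Qed.

Let ba : adj b a. Proof. by rewrite adj_sym. Qed.

Lemma color2_degree x y z : g x = 2 -> adj x y -> adj x z -> y = z.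
Proof.
move=> gx xy xz; apply: (@g3 _ _ _ xy xz).
by move: (g1 y) (g1 z) (g2 xy) (g2 xz); lia.
Qed.

(** A neighbor of [a] without color 2 has color 3, so its edge to [a] has the same color as [ab]. *)
Lemma adj_a_cases x : adj a x -> x = b \/ g x = 2.
Proof.
move=> ax; have [gx|gx] := eqVneq (g x) 2; [by right|left].
by apply: (@g3 _ _ _ ax ab); move: (g1 x) (g2 ax); lia.
Qed.

Lemma adj_b_cases x : adj b x -> x = a \/ g x = 2.
Proof.
move=> bx; have [gx|gx] := eqVneq (g x) 2; [by right|left].
by apply: (@g3 _ _ _ bx ba); move: (g1 x) (g2 bx); lia.
Qed.

(** The set of these vertices contains [a] and is closed under adjacency, hence is everything by
    connectedness. *)
Lemma near_edge x : [|| x == a, x == b, adj a x | adj b x].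
Proof.
pose S := [pred x | [|| x == a, x == b, adj a x | adj b x]].
have S_closed : closed (@adj G) S.
  apply: (intro_closed (sym_connect_sym (@adj_sym G))) => y z yz.
  (* A step from a vertex of color 2 can only lead back to its unique neighbor [t], here [a] or
     [b]. *)
  have color2 t : adj t y -> g y = 2 -> t = z.
    by rewrite adj_sym => yt gy; apply: color2_degree gy yt yz.
  rewrite !inE => /or4P[/eqP ya|/eqP yb|ay|bt].
  - by rewrite -ya yz !orbT.
  - by rewrite -yb yz !orbT.
  - case: (adj_a_cases ay) => [yb|/(color2 _ ay) ->]; last by rewrite eqxx.
    by rewrite -yb yz !orbT.
  - case: (adj_b_cases bt) => [ya|/(color2 _ bt) ->]; last by rewrite eqxx !orbT.
    by rewrite -ya yz !orbT.
have := closed_connect S_closed (hG.2 a x).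
by rewrite !inE eqxx.
Qed.

(** The index in the path colored 2, 1, 3, 2, with [a] at 1 and [b] at 2. The final default 3 is
    right because, by [near_edge], a vertex of color 2 not adjacent to [a] is adjacent to [b]. *)
Definition position (x : G) : nat :=
  if g x == 1 then 1 else if g x == 3 then 2 else if adj a x then 0 else 3.

Variant position_spec (x : G) : nat -> Prop :=
  | PositionA of x = a : position_spec x 1
  | PositionB of x = b : position_spec x 2
  | PositionNearA of g x = 2 & adj a x & adj b x = false : position_spec x 0
  | PositionNearB of g x = 2 & adj b x & adj a x = false : position_spec x 3.

Lemma positionP x : position_spec x (position x).
Proof.
have nab : a <> b by move=> eab; have := ga; rewrite eab gb.
(* Otherwise [y], of color 2, would have the two distinct neighbors [a] and [b]. *)
have one_side y : g y = 2 -> adj a y -> adj b y -> False.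
  by rewrite ![adj _ y]adj_sym => gy ya yb; apply: nab; apply: color2_degree gy ya yb.
rewrite /position.
case/or4P: (near_edge x) => [/eqP ->|/eqP ->|ax|bx].
- by rewrite ga; constructor.
- by rewrite gb; constructor.
- case: (adj_a_cases ax) => [->|gx]; first by rewrite gb; constructor.
  rewrite gx ax; constructor=> //; apply/negP; exact: one_side.
- case: (adj_b_cases bx) => [->|gx]; first by rewrite ga; constructor.
  have nax : adj a x = false by apply/negP => ax; apply: (one_side x).
  by rewrite gx nax; constructor.
Qed.

(** Two vertices at the same end have color 2 and share the neighbor [a] or [b], so their edges to
    it have equal colors. *)
Lemma position_inj : injective position.
Proof.
move=> x y.
case: positionP => [->|->|gx nx _|gx nx _];
  case: positionP => [->|->|gy ny _|gy ny _] // _.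
  by apply: (@g3 _ _ _ nx ny); rewrite gx gy.
by apply: (@g3 _ _ _ nx ny); rewrite gx gy.
Qed.

Lemma position_adj x y :
  adj x y = ((position x).+1 == position y) || ((position y).+1 == position x).
Proof.
(* This keeps the two ends, at positions 0 and 3, from being adjacent and closing a cycle. *)
have n22 u v : g u = 2 -> g v = 2 -> adj u v = false.
  by move=> gu gv; apply/negP => /g2; rewrite gu gv.
case: positionP => [->|->|gx ax bx|gx bx ax];
  case: positionP => [->|->|gy ay by_|gy by_ ay];
  rewrite ?adj_irrefl ?ab ?ba ?ay ?by_ ?[adj x _]adj_sym ?ax ?bx ?(n22 y x) //.
Qed.

Lemma position_path_placement : path_placement position.
Proof. by split; [apply: position_inj | apply: position_adj]. Qed.

Lemma graceful_coloring3_iso :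
  ~~ gracefully_colorable G 2 ->
  exists n, (n = 3 \/ n = 4) /\ graph_iso G (path_graph n).
Proof.
move=> n2; have pp := position_path_placement.
have p_le3 x : position x <= 3 by case: positionP.
have p1 : exists x, position x = 1 by exists a; rewrite /position ga.
have p2 : exists x, position x = 2 by exists b; rewrite /position gb.
have occupied i :
    (exists x, position x = i) \/ (forall x, position x <> i).
  have [/existsP[x /eqP xi]|/existsPn ni] := boolP [exists x, position x == i].
    by left; exists x.
  by right=> x; apply/eqP.
(* Positions 1 and 2 are always taken. Both ends occupied give the path on 4 vertices, one end gives
   the path on 3, and none leaves a single edge, which is 2-colorable. *)
case: (occupied 0) => [p0|n0]; case: (occupied 3) => [p3|n3].
- exists 4; split; [by right|apply: (path_placement_iso (k := 0) pp)] => [x|].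
    by have := p_le3 x; lia.
  by case=> [|[|[|[|]]]].
- exists 3; split; [by left|apply: (path_placement_iso (k := 0) pp)] => [x|].
    by have := p_le3 x; have := n3 x; lia.
  by case=> [|[|[|]]].
- exists 3; split; [by left|apply: (path_placement_iso (k := 1) pp)] => [x|].
    by have := p_le3 x; have := n0 x; lia.
  by case=> [|[|[|]]].
- case/negP: n2; apply: (path_placement_colorable2 pp) => x.
  by have := p_le3 x; have := n0 x; have := n3 x; lia.
Qed.

End PathPlacement.

Lemma graph_iso_path_chromatic3 (G : sgraph) (n : nat) :
  2 < n <= 4 -> graph_iso G (path_graph n) -> graceful_chromatic_number G = 3.
Proof.
move=> n34 [f [[h fK hK] f_adj]]; apply/graceful_chromatic_number3E.
have h_adj i j : adj (h i) (h j) = path_adj i j by rewrite -f_adj !hK.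
split.
  (* The edges along this list get colors 1, 2, 1; its first three entries serve for [n = 3]. The
     default 0 is never reached, since [f x < 4]. *)
  apply/gracefully_colorableP; exists (fun x => nth 0 [:: 2; 1; 3; 2] (f x)).
  have f_lt x : f x < 4 by have := ltn_ord (f x); lia.
  apply/graceful_coloringP; split=> [x|x y|x y z].
  - by case: (nat_of_ord _) (f_lt x) => [|[|[|[|]]]].
  - rewrite -f_adj /= /path_adj; move: (f_lt x) (f_lt y).
    by case: (nat_of_ord (f x)) => [|[|[|[|]]]] //;
      case: (nat_of_ord (f y)) => [|[|[|[|]]]].
  - rewrite -!f_adj /= /path_adj => xy xz gyz; apply: (can_inj fK).
    apply: val_inj => /=; move: (f_lt x) (f_lt y) (f_lt z) xy xz gyz.
    by case: (nat_of_ord (f x)) => [|[|[|[|]]]] //;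
      case: (nat_of_ord (f y)) => [|[|[|[|]]]] //;
      case: (nat_of_ord (f z)) => [|[|[|[|]]]].
have [n0 n1 n2] : [/\ 0 < n, 1 < n & 2 < n] by split; lia.
(* The vertex at index 1 has the two neighbors at indices 0 and 2. *)
apply: (@not_gracefully_colorable2 _
  (h (Ordinal n1)) (h (Ordinal n0)) (h (Ordinal n2))); rewrite ?h_adj //.
by rewrite (can_eq hK).
Qed.

Theorem theorem3p2 (G : sgraph) (hG : connected_graph G) :
  graceful_chromatic_number G = 3 <->
  (exists n : nat, (n = 3 \/ n = 4) /\ graph_iso G (path_graph n)).
Proof.
split=> [/graceful_chromatic_number3E[/gracefully_colorableP[g hg] n2]|].
  have [/existsP[a /existsP[b /and3P[ab /eqP ga /eqP gb]]]|n13] :=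
    boolP [exists a : G, exists b : G, [&& adj a b, g a == 1 & g b == 3]].
    exact: graceful_coloring3_iso hG hg ab ga gb n2.
  case/negP: n2; apply/gracefully_colorableP.
  exists (fun x => if g x == 2 then 2 else 1).
  apply: graceful_coloring_merge13 hg _ => x y xy gx gy; case/negP: n13.
  by apply/existsP; exists x; apply/existsP; exists y; rewrite xy gx gy.
by case=> n [n34 iso]; apply: graph_iso_path_chromatic3 iso; case: n34 => ->.
Qed.
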